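(* Let $k$ be an algebraically closed field of characteristic $2$ and let $G$ be a finite group of even order. Let $M$ be a non-trivial self-dual irreducible $kG$-module and let $B$ be a symplectic $G$-form on $M$. Then the projective cover $P(M)$ has quadratic type if and only if there is an involution $t\in G$ such that $B(tm,m)\neq 0$ for some $m\in M$.
   Context: All modules are finite-dimensional left modules. A symplectic $G$-form on a $kG$-module $M$ is a non-degenerate $G$-invariant bilinear form $B:M\times M\to k$ with $B(m,m)=0$ for all $m\in M$. A $kG$-module has quadratic type if it affords a symplectic $G$-form that is the polarization $(m_1,m_2)\mapsto Q(m_1+m_2)-Q(m_1)-Q(m_2)$ of a $G$-invariant quadratic form $Q$. An involution is an element of order $2$. $P(M)$ denotes the projective cover of $M$. *)

(* Defs.v *)
From HB Require Import structures.
From mathcomp Require Import all_boot all_order all_algebra all_fingroup.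
From mathcomp Require Import sesquilinear mxrepresentation.

Set Implicit Arguments.
Unset Strict Implicit.
Unset Printing Implicit Defensive.

Import GroupScope GRing.Theory.
Local Open Scope ring_scope.

(* A finite-dimensional kG-module of dimension n is an mx_representation k G n
   acting on row vectors. Matrices act on row vectors from the right, so the
   underlying left module has g.m = m *m rG g^-1 (lact below). Submodules
   (mxmodule), irreducibility (mx_irreducible) and homomorphisms are the same
   for the left and the right structure. *)

Section Modules.

Variables (k : fieldType) (gT : finGroupType) (G : {group gT}).

Definition lact n (rM : mx_representation k G n) (g : gT) (m : 'rV[k]_n) :
  'rV[k]_n := m *m rM g^-1%g.

(* A linear map 'rV_a -> 'rV_b is the matrix f sending m to m *m f; it is
   surjective iff row_full f. *)
Definition mx_hom a b (rA : mx_representation k G a)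
    (rB : mx_representation k G b) (f : 'M[k]_(a, b)) : Prop :=
  forall g, g \in G -> rA g *m f = f *m rB g.

Lemma triv_mx_repr : mx_repr G (fun _ : gT => 1%:M : 'M[k]_1).
Proof. by split=> // x y _ _; rewrite mul1mx. Qed.

Definition triv_repr := MxRepresentation triv_mx_repr.

Section Dual.

Variables (n : nat) (rM : mx_representation k G n).

(* A functional on 'rV_n is given by its row of coordinates in the dual basis,
   phi standing for m |-> m *m phi^T; then (g.phi)(m) = phi(g^-1.m). *)
Definition dual_mx (g : gT) : 'M[k]_n := (rM g^-1%g)^T.

Lemma dual_mx_repr : mx_repr G dual_mx.
Proof.
split=> [|x y Gx Gy]; rewrite /dual_mx; first by rewrite invg1 repr_mx1 trmx1.
by rewrite invMg repr_mxM ?groupV // trmx_mul.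
Qed.

Definition dual_repr := MxRepresentation dual_mx_repr.

Definition self_dual : Prop := mx_rsim rM dual_repr.

End Dual.

Definition projective p (rP : mx_representation k G p) : Prop :=
  forall a b (rA : mx_representation k G a) (rB : mx_representation k G b)
         (h : 'M[k]_(a, b)) (f : 'M[k]_(p, b)),
    mx_hom rA rB h -> row_full h -> mx_hom rP rB f ->
    exists2 f' : 'M[k]_(p, a), mx_hom rP rA f' & f' *m h = f.

(* The last clause says that pi is essential: no proper submodule of P is
   mapped onto M. *)
Definition projective_cover p n (rP : mx_representation k G p)
    (rM : mx_representation k G n) (pi : 'M[k]_(p, n)) : Prop :=
  [/\ projective rP, mx_hom rP rM pi, row_full pi
    & forall U : 'M[k]_p, mxmodule rP U -> row_full (U *m pi) -> row_full U].

Section Forms.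

Variables (n : nat) (rM : mx_representation k G n).

(* B is alternating, hence skew-symmetric, so its left and right radicals
   coincide. *)
Definition symplectic_form (B : {biscalar 'rV[k]_n}) : Prop :=
  [/\ forall u, (forall v, B u v = 0) -> u = 0,
      forall g, g \in G -> forall u v, B (lact rM g u) (lact rM g v) = B u v
    & forall u, B u u = 0].

Definition polarization (Q : 'rV[k]_n -> k) (u v : 'rV[k]_n) : k :=
  Q (u + v) - Q u - Q v.

Definition quadratic_form (Q : 'rV[k]_n -> k) : Prop :=
  (forall (a : k) u, Q (a *: u) = a ^+ 2 * Q u)
  /\ bilinear_for *%R *%R (polarization Q).

Definition quadratic_type : Prop :=
  exists (B : {biscalar 'rV[k]_n}) (Q : 'rV[k]_n -> k),
    [/\ symplectic_form B, quadratic_form Q,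
        forall g, g \in G -> forall u, Q (lact rM g u) = Q u
      & forall u v, B u v = polarization Q u v].

End Forms.

End Modules.

(* Main.v *)
Require Import Defs.
From HB Require Import structures.
From mathcomp Require Import all_boot all_order all_algebra all_fingroup.
From mathcomp Require Import cyclic sesquilinear mxrepresentation ring.

(** Everything is computed with right modules, so that a form B on M is
    invariant when B(xg, yg) = B(x, y).

    Fix a non-zero m in M and p0 in P lying over it. As P -> M is essential, p0
    generates P, and projectivity splits the surjection kG -> P, x |-> p0 x.
    The splitting is recorded by one linear functional eps on P:
    v = sum_h eps(v h^-1) p0 h for every v ([projective_dual_basis]). So p0 is
    fixed by e = sum_h e_h h with e_h = eps(p0 h^-1), the idempotent of kG
    with P isomorphic to ekG, and m e = m. Write e' = sum_h e_h h^-1 for the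
    adjoint of e.

    Suppose B(mt, m) <> 0 for an involution t. On the dual P^* of P consider
    the form sum_h phi(p0 h) psi(p0 t h). It is the polarization of the
    invariant quadratic form phi |-> sum_C prod_(h in C) phi(p0 h), where C runs
    over the cosets <t>h, that is, over the unordered pairs {h, th}
    ([transfer_quadratic_type]). It is the pairing of P^* with P composed with
    the homomorphism A : P^* -> P, A = sum_h (p0 h)^T (p0 t h), so it remains
    to see that A is onto. By essentiality this only needs P^* -> P -> M to be
    non-zero, and it maps eps to mte', where B(m, mte') = B(me, mt) =
    B(m, mt) <> 0. The inverse of A then carries the quadratic form from P^*
    to P ([involution_quadratic_type]).

    Conversely let b be a symplectic form on P and F(z) = b(p0, p0 z). Since k
    is algebraically closed, Hom(P, M) is spanned by the projection P -> M
    ([cover_hom_scalar]). Hence Me is the line km, and so Me' is a line ku, with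
    B(m, u) <> 0. The element s = sum_h B(uh, m) p0 h is non-zero because
    eps(s) = B(m, u), so b(s, p0 g) <> 0 for some g. Using p0 = p0 e, this
    value turns out to be a multiple of sum_z F(z) B(u, uz). The terms of z
    and z^-1 agree, hence cancel in characteristic 2, and F(1) = 0; so some
    involution z has B(u, uz) <> 0 ([symplectic_cover_involution]). *)

Set Implicit Arguments.
Unset Strict Implicit.
Unset Printing Implicit Defensive.

Import GroupScope GRing.Theory.
Local Open Scope ring_scope.

(** * Sums over a finite group *)

Section GroupSums.

Variables (V : nmodType) (gT : finGroupType) (G : {group gT}) (F : gT -> V).

Lemma sum_group_mulr g :
  g \in G -> \sum_(h in G) F (h * g)%g = \sum_(h in G) F h.
Proof.
move=> Gg; rewrite [RHS](reindex_inj (mulIg g)).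
by apply: eq_bigl => h; rewrite groupMr.
Qed.

Lemma sum_group_mull g :
  g \in G -> \sum_(h in G) F (g * h)%g = \sum_(h in G) F h.
Proof.
move=> Gg; rewrite [RHS](reindex_inj (mulgI g)).
by apply: eq_bigl => h; rewrite groupMl.
Qed.

Lemma sum_group_inv : \sum_(h in G) F h^-1%g = \sum_(h in G) F h.
Proof.
by rewrite [RHS](reindex_inj invg_inj); apply: eq_bigl => h; rewrite groupV.
Qed.

End GroupSums.

(** In characteristic 2 the pairs {x, x^-1} with x <> x^-1 contribute nothing to
    the sum of an inversion-invariant function. *)
Lemma sum_inv_pairs (R : zmodType) (gT : finGroupType) (G : {group gT})
    (a : gT -> R) :
  (forall r : R, r + r = 0) ->
  {in G, forall x, a x^-1%g = a x} ->
  \sum_(x in G) a x = \sum_(x in G | (x * x)%g == 1%g) a x.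
Proof.
move=> R2 aV; rewrite (bigID (fun x => (x * x)%g == 1%g)) /=.
rewrite -[RHS]addr0; congr (_ + _).
(* The enumeration ranks choose one element of each pair. *)
rewrite (bigID (fun x => enum_rank x < enum_rank x^-1%g)%N) /=.
set S1 := (X in X + _ = 0); set S2 := (X in _ + X = 0).
suff -> : S1 = S2 by rewrite R2.
rewrite /S1 /S2 (reindex_inj invg_inj) /=; apply: eq_big => [x | x].
  rewrite groupV invgK -invMg invg_eq1 -leqNgt.
  have [xx | xx] := eqVneq (x * x)%g 1%g; rewrite ?andbF //= ltn_neqAle.
  suff -> : nat_of_ord (enum_rank x^-1%g) != enum_rank x by rewrite andbT.
  rewrite (inj_eq val_inj) (inj_eq enum_rank_inj).
  by apply: contra xx => /eqP {1}<-; rewrite mulVg.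
by case/andP=> /andP[]; rewrite groupV => Gx _ _; rewrite aV.
Qed.

(** * Forms *)

Lemma biscalar_of_bilinear (k : fieldType) n (f : 'rV[k]_n -> 'rV[k]_n -> k) :
  bilinear_for *%R *%R f ->
  exists B : {biscalar 'rV[k]_n}, forall u v, B u v = f u v.
Proof.
move=> bilf.
pose F := bilinear_isBilinear.Build k _ _ _ *%R *%R f bilf.
by exists (HB.pack_for {biscalar 'rV[k]_n} f F).
Qed.

Lemma nondegenerate_neq0 (k : fieldType) n (B : {biscalar 'rV[k]_n}) u :
  (forall u, (forall v, B u v = 0) -> u = 0) -> u != 0 ->
  exists v, B u v != 0.
Proof.
move=> Bnd u0; have [/existsP[i Bi] | /existsPn B0] :=
  boolP [exists i : 'I_n, B u 'e_i != 0]; first by exists 'e_i.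
case/eqP: u0; apply: Bnd => v; rewrite [v]row_sum_delta linear_sumr.
by apply: big1 => i _; rewrite linearZr_LR /= (eqP (negbNE (B0 i))) mulr0.
Qed.

Section InvariantForms.

Variables (k : fieldType) (gT : finGroupType) (G : {group gT}) (n : nat).

Lemma symplectic_invariantr (rM : mx_representation k G n)
    (B : {biscalar 'rV[k]_n}) :
  symplectic_form rM B ->
  forall g, g \in G -> forall u v, B (u *m rM g) (v *m rM g) = B u v.
Proof.
case=> _ BG _ g Gg u v; rewrite -[RHS](BG g^-1%g) ?groupV //.
by rewrite /lact invgK.
Qed.

Lemma symplectic_sym (rM : mx_representation k G n) (B : {biscalar 'rV[k]_n}) :
  2%N \in [pchar k] -> symplectic_form rM B -> forall u v, B u v = B v u.
Proof.
move=> k2 [_ _ Balt] u v; have := Balt (u + v).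
rewrite linearDl !linearDr !Balt addr0 add0r => /eqP.
by rewrite addr_eq0 => /eqP->; apply/esym/eqP; rewrite -addr_eq0 addrr_pchar2.
Qed.

Lemma quadratic_type_inj (rV rW : mx_representation k G n) (f : 'M[k]_n) :
  mx_hom rV rW f -> f \in unitmx -> quadratic_type rW -> quadratic_type rV.
Proof.
move=> homf uf [B [Q [[Bnd BG Balt] [QZ Qpol] QG BQ]]].
have bilB : bilinear_for *%R *%R (fun u v => B (u *m f) (v *m f)).
  by split=> w a u v /=; rewrite mulmxDl -scalemxAl (linearPl, linearPr).
have [B' B'E] := biscalar_of_bilinear bilB.
have lactf g u : g \in G -> lact rV g u *m f = lact rW g (u *m f).
  by move=> Gg; rewrite /lact -!mulmxA homf ?groupV.
exists B', (fun u => Q (u *m f)); split.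
- split=> [u Bu0 | g Gg u v | u]; rewrite ?B'E ?lactf ?BG //.
  rewrite -[u](mulmxK uf) [u *m f]Bnd ?mul0mx // => v.
  by rewrite -[v](mulmxKV uf) -B'E.
- split=> [a u | ]; first by rewrite -scalemxAl QZ.
  split=> w a u v; rewrite /polarization; have := bilB.2 w a u v;
    by have := bilB.1 w a u v; rewrite /= !BQ /polarization !mulmxDl.
- by move=> g Gg u; rewrite lactf ?QG.
- by move=> u v; rewrite B'E BQ /polarization mulmxDl.
Qed.

End InvariantForms.

(** * The quadratic form of a functional and an involution *)

Section Transfer.

Variables (k : fieldType) (gT : finGroupType) (G : {group gT}) (d : nat).
Variables (rV : mx_representation k G d) (l : 'cV[k]_d) (t : gT).

(** The inverse makes right translation of u translate the argument h on the
    right, so that the group permutes the right cosets of <[t]>. *)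
Definition orbval (u : 'rV[k]_d) (h : gT) : k := (u *m rV h^-1%g *m l) 0 0.

Definition transfer_form u v := \sum_(h in G) orbval u h * orbval v (t * h).

(** For an involution t the cosets are the pairs {h, th}: this is half of
    transfer_form u u, made sense of in characteristic 2. *)
Definition transfer_quad u :=
  \sum_(C in rcosets <[t]> G) \prod_(h in C) orbval u h.

Lemma orbvalP a u v h : orbval (a *: u + v) h = a * orbval u h + orbval v h.
Proof. by rewrite /orbval !mulmxDl -!scalemxAl !mxE. Qed.

Lemma transfer_form_bilinear : bilinear_for *%R *%R transfer_form.
Proof.
split=> w a u v; rewrite /transfer_form /= mulr_sumr -big_split /=;
  apply: eq_bigr => h _; rewrite orbvalP.
  by rewrite mulrDl mulrA.
by rewrite mulrDr mulrCA.
Qed.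

Lemma orbval_lact u g h : g \in G -> h \in G ->
  orbval (lact rV g u) h = orbval u (h * g)%g.
Proof.
by move=> Gg Gh; rewrite /orbval /lact invMg repr_mxM ?groupV // !mulmxA.
Qed.

Hypotheses (Gt : t \in G) (ot : #[t] = 2%N).

Lemma rcoset_involution h : <[t]> :* h = [set h; (t * h)%g].
Proof. by rewrite cycle2g // mulUg !mulg_set1 mul1g. Qed.

Lemma notin_involution_translate h : h \notin [set (t * h)%g].
Proof.
by rewrite inE -[eqbLHS]mul1g (inj_eq (mulIg h)) eq_sym -order_gt1 ot.
Qed.

Lemma transfer_quad_coset h u :
  \prod_(x in <[t]> :* h) orbval u x = orbval u h * orbval u (t * h).
Proof.
by rewrite rcoset_involution big_setU1 ?big_set1 ?notin_involution_translate.
Qed.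

Lemma transfer_quad_polar u v :
  polarization transfer_quad u v = transfer_form u v.
Proof.
have sTG : <[t]> \subset G by rewrite cycle_subG.
rewrite /polarization /transfer_quad /transfer_form.
rewrite (set_partition_big _ (rcosets_partition sTG)) -!sumrB.
apply: eq_bigr => _ /rcosetsP[h Gh ->]; rewrite !transfer_quad_coset.
have tt : (t * (t * h))%g = h by rewrite -{1}(invg2id ot) mulKg.
rewrite rcoset_involution big_setU1 ?notin_involution_translate //=.
by rewrite big_set1 tt -[u]scale1r !orbvalP scale1r; ring.
Qed.

Lemma transfer_quad_lact g u : g \in G ->
  transfer_quad (lact rV g u) = transfer_quad u.
Proof.
move=> Gg; have sTG : <[t]> \subset G by rewrite cycle_subG.
rewrite /transfer_quad [RHS](reindex_inj (can_inj (rcosetK g))) /=.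
have rcg C : (C :* g \in rcosets <[t]> G) = (C \in rcosets <[t]> G).
  apply/rcosetsP/rcosetsP=> [] [h Gh Ch].
    exists (h * g^-1)%g; first by rewrite groupM ?groupV.
    by rewrite -[LHS](rcosetK g) Ch !rcosetM.
  by exists (h * g)%g; rewrite ?groupM // Ch !rcosetM.
apply: eq_big => [C | C CG]; first by rewrite rcg.
rewrite [RHS](reindex_inj (mulIg g)) /=; apply: eq_big => [h | h hC].
  by rewrite mem_rcoset mulgK.
rewrite orbval_lact //; case/rcosetsP: CG hC => x Gx ->.
by apply: subsetP; rewrite mul_subG // sub1set.
Qed.

Lemma transfer_quadratic_type :
  2%N \in [pchar k] ->
  (forall u, (forall v, transfer_form u v = 0) -> u = 0) -> quadratic_type rV.
Proof.
move=> k2 nd; have [B BE] := biscalar_of_bilinear transfer_form_bilinear.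
have Bpol u v : B u v = polarization transfer_quad u v.
  by rewrite BE transfer_quad_polar.
have QZ a u : transfer_quad (a *: u) = a ^+ 2 * transfer_quad u.
  rewrite /transfer_quad mulr_sumr; apply: eq_bigr => _ /rcosetsP[h Gh ->].
  rewrite !transfer_quad_coset -[a *: u]addr0 !orbvalP.
  by rewrite /orbval !mul0mx !mxE; ring.
exists B, transfer_quad; split=> //; last first.
- by move=> g Gg u; rewrite transfer_quad_lact.
- split=> //; split=> w a u v; rewrite /= !transfer_quad_polar.
    exact: transfer_form_bilinear.1.
  exact: transfer_form_bilinear.2.
- split=> [u Bu | g Gg u v | u].
  + by apply: nd => v; rewrite -BE.
  + rewrite !Bpol /polarization.
    by rewrite {1}/lact -mulmxDl -/(lact rV g (u + v)) !transfer_quad_lact.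
  + rewrite Bpol /polarization -mulr2n -scaler_nat (pcharf0 k2) scale0r.
    rewrite -(scale0r u) QZ expr0n mul0r sub0r -opprD.
    by rewrite addrr_pchar2 // oppr0.
Qed.

End Transfer.

(** * Projective modules with one generator *)

Section Modules.

Variables (k : fieldType) (gT : finGroupType) (G : {group gT}).

Lemma irr_image_full a b (rA : mx_representation k G a)
    (rB : mx_representation k G b) (f : 'M[k]_(a, b)) m (U : 'M[k]_(m, a)) :
  mx_irreducible rB -> mx_hom rA rB f -> mxmodule rA U -> U *m f != 0 ->
  row_full (U *m f).
Proof.
case/mx_irrP=> _ irrB homf modU Uf0.
have: row_full <<U *m f>>%MS.
  apply: irrB; last by rewrite (eqmx_eq0 (genmxE _)).
  rewrite (eqmx_module _ (genmxE _)); apply/mxmoduleP=> g Gg.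
  by rewrite -mulmxA -homf // mulmxA submxMr // (mxmoduleP modU).
by rewrite (eq_row_full (genmxE _)).
Qed.

(** A generator p0 gives a surjection from the regular module; eps is the
    coefficient at 1 of a splitting of it, and equivariance of the splitting
    recovers all the other coefficients from that one. *)
Lemma projective_dual_basis p (rP : mx_representation k G p) (p0 : 'rV[k]_p) :
  projective rP -> row_full (cyclic_mx rP p0) ->
  exists eps : 'cV[k]_p, forall v : 'rV[k]_p,
    v = \sum_(h in G) orbval rP eps v h *: (p0 *m rP h).
Proof.
move=> projP cycP.
pose gen : 'M[k]_(gcard G, p) := \matrix_i (p0 *m rP (enum_val i)).
have row_gen h : h \in G -> row (gring_index G h) gen = p0 *m rP h.
  by move=> Gh; rewrite rowK gring_indexK.
have homgen : mx_hom (regular_repr k G) rP gen.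
  move=> g Gg; apply/row_matrixP=> i; rewrite !row_mul !rowK -rowE.
  have Gi := enum_valP i.
  by rewrite row_gen ?groupM // repr_mxM // mulmxA.
have fullgen : row_full gen.
  suff cycgen : (cyclic_mx rP p0 <= gen)%MS.
    by rewrite -sub1mx (submx_trans _ cycgen) ?sub1mx.
  apply: cyclic_mx_sub; last first.
    by rewrite -[p0]mulmx1 -(repr_mx1 rP) -row_gen ?group1 ?row_sub.
  by apply/mxmoduleP=> g Gg; rewrite -homgen // submxMl.
have homid : mx_hom rP rP 1%:M by move=> g _; rewrite mulmx1 mul1mx.
have [f homf fgen] := projP _ _ _ _ _ _ homgen fullgen homid.
exists (col (gring_index G 1%g) f) => v.
rewrite -[v in LHS]mulmx1 -fgen mulmxA mulmx_sum_row.
rewrite [RHS]big_enum_val; apply: eq_bigr => i _; rewrite rowK; congr (_ *: _).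
rewrite /orbval.
have Gi := enum_valP i; have GVi : (enum_val i)^-1%g \in G by rewrite groupV.
rewrite colE mulmxA -colE [RHS]mxE -mulmxA homf // mulmxA [RHS]mxE.
rewrite (bigD1 i) //= [X in _ = _ + X]big1 => [|j ij]; rewrite !mxE /=.
  by rewrite mulgV !eqxx mulr1 addr0.
rewrite (inj_in_eq (can_in_inj (@gring_indexK _ G))) ?groupM ?enum_valP //.
by rewrite eq_sym -eq_mulgV1 (inj_eq enum_val_inj) (negPf ij) mulr0.
Qed.

End Modules.

Section GroupAlgebra.

Variables (k : fieldType) (gT : finGroupType) (G : {group gT}) (n : nat).
Variable rM : mx_representation k G n.

Definition galg_act (e : gT -> k) (x : 'rV[k]_n) : 'rV[k]_n :=
  \sum_(h in G) e h *: (x *m rM h).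

Lemma galg_act_adjoint (B : {biscalar 'rV[k]_n}) (e : gT -> k) x y :
  (forall g, g \in G -> forall u v, B (u *m rM g) (v *m rM g) = B u v) ->
  B (galg_act e x) y = B x (galg_act (fun h => e h^-1%g) y).
Proof.
move=> BG; rewrite linear_sumlz linear_sumr /=.
rewrite -[RHS]sum_group_inv; apply: eq_bigr => h Gh.
rewrite invgK linearZl_LR linearZr_LR /= -(BG h Gh x).
by rewrite repr_mxKV.
Qed.

End GroupAlgebra.

Lemma hom_galg_act (k : fieldType) (gT : finGroupType) (G : {group gT})
    (a b : nat) (rA : mx_representation k G a) (rB : mx_representation k G b)
    (f : 'M[k]_(a, b)) e v :
  mx_hom rA rB f -> galg_act rA e v *m f = galg_act rB e (v *m f).
Proof.
move=> homf; rewrite mulmx_suml; apply: eq_bigr => h Gh.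
by rewrite -scalemxAl -!mulmxA homf.
Qed.

(** * The projective cover of an irreducible module *)

Section Cover.

Variables (k : fieldType) (gT : finGroupType) (G : {group gT}) (p n : nat).
Variables (rP : mx_representation k G p) (rM : mx_representation k G n).
Variable pi : 'M[k]_(p, n).
Hypotheses (irrM : mx_irreducible rM) (coverP : projective_cover rP rM pi).

(** Any lift p0 of m generates P, as the submodule it generates maps onto M. *)
Lemma cover_dual_basis (m : 'rV[k]_n) : m != 0 ->
  exists (p0 : 'rV[k]_p) (eps : 'cV[k]_p), p0 *m pi = m /\
  forall v, v = \sum_(h in G) orbval rP eps v h *: (p0 *m rP h).
Proof.
move=> m0; have [projP hompi fullpi esspi] := coverP.
pose p0 := m *m pinvmx pi.
have p0pi : p0 *m pi = m by rewrite mulmxKpV // submx_full.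
exists p0; have [|eps epsP] := @projective_dual_basis _ _ _ _ rP p0 projP.
  apply: (esspi _ (cyclic_mx_module _ _)).
  apply: (irr_image_full irrM hompi (cyclic_mx_module _ _)).
  apply: contraNneq m0 => c0; rewrite -p0pi.
  by have [D ->] := submxP (cyclic_mx_id rP p0); rewrite -mulmxA c0 mulmx0.
by exists eps.
Qed.

(** The transfer form lives naturally on the dual of P, where evaluation at p0
    is a functional; that its matrix A is a homomorphism from the dual of P to P
    gives both the non-degeneracy, by essentiality, and the way back to P. *)
Lemma involution_quadratic_type (B : {biscalar 'rV[k]_n}) t m :
  2%N \in [pchar k] -> symplectic_form rM B ->
  t \in G -> #[t]%g = 2%N -> B (m *m rM t) m != 0 -> quadratic_type rP.
Proof.
move=> k2 sympB Gt ot Btm; have [projP hompi fullpi esspi] := coverP.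
have BG := symplectic_invariantr sympB.
have m0 : m != 0 by apply: contraNneq Btm => ->; rewrite linear0r.
have [p0 [eps [p0pi epsP]]] := cover_dual_basis m0.
pose e := orbval rP eps p0.
pose A := \sum_(h in G) (p0 *m rP h)^T *m (p0 *m rP (t * h)%g).
have homA : mx_hom (dual_repr rP) rP A.
  move=> g Gg; rewrite /= /dual_mx mulmx_sumr mulmx_suml.
  rewrite -(sum_group_mulr _ Gg); apply: eq_bigr => h Gh.
  rewrite [LHS]mulmxA -trmx_mul -(mulmxA p0) -repr_mxM ?groupM ?groupV // mulgK.
  by rewrite mulgA (repr_mxM rP (groupM Gt Gh) Gg) !mulmxA.
have actm : galg_act rM e m = m.
  by rewrite -p0pi -(hom_galg_act _ _ hompi) {2}(epsP p0).
have Api0 : A *m pi != 0.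
  apply: contraNneq Btm => Api.
  rewrite (symplectic_sym k2 sympB) -{1}actm galg_act_adjoint //.
  have eV h : h \in G -> e h^-1%g = (eps^T *m (p0 *m rP h)^T) 0 0.
    by move=> Gh; rewrite -trmx_mul mxE /e /orbval invgK.
  (* The left-hand side is the image of eps under A and pi. *)
  suff -> : galg_act rM (fun h => e h^-1%g) (m *m rM t) = 0.
    by rewrite linear0r.
  rewrite -[RHS](mulmx0 _ eps^T) -Api mulmxA mulmx_sumr mulmx_suml.
  apply: eq_bigr => h Gh.
  rewrite mulmxA [eps^T *m _]mx11_scalar mul_scalar_mx -scalemxAl eV //.
  by rewrite -(mulmxA p0) hompi ?groupM // mulmxA p0pi repr_mxM // mulmxA.
have modA : mxmodule rP A by apply/mxmoduleP=> g Gg; rewrite -homA // submxMl.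
have Aunit : A \in unitmx.
  rewrite -row_full_unit; apply: (esspi _ modA).
  exact: (irr_image_full irrM hompi modA).
have dualtype : quadratic_type (dual_repr rP).
  apply: (transfer_quadratic_type (l := p0^T) Gt ot k2) => u u0.
  suff uA : u *m A = 0 by rewrite -[u](mulmxK Aunit) uA mul0mx.
  have orbE w x : orbval (dual_repr rP) p0^T w x = (w *m (p0 *m rP x)^T) 0 0.
    by rewrite /orbval /= /dual_mx invgK trmx_mul mulmxA.
  apply/rowP=> i; rewrite [RHS]mxE -(u0 'e_i) mulmx_sumr summxE.
  apply: eq_bigr => h Gh; rewrite !orbE mulmxA -rowE [LHS]mxE big_ord1.
  by rewrite [row _ _ _ _]mxE [_^T i 0]mxE.
apply: (quadratic_type_inj (f := invmx A)) dualtype => [g Gg|].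
  by rewrite -[RHS](mulmxK Aunit) -(mulmxA _ _ A) homA // mulKmx.
by rewrite unitmx_inv.
Qed.

End Cover.

(** * Symplectic forms on the cover over an algebraically closed field *)

Lemma closedField_eigenvalue (k : closedFieldType) n (A : 'M[k]_n) :
  (0 < n)%N -> exists c, exists2 v : 'rV_n, v *m A = c *: v & v != 0.
Proof.
move=> n0; have /closed_rootP[c rc] : size (char_poly A) != 1%N.
  by rewrite size_char_poly; case: n n0 A.
by exists c; apply/eigenvalueP; rewrite eigenvalue_root_char.
Qed.

Section ClosedCover.

Variables (k : closedFieldType) (gT : finGroupType) (G : {group gT}).
Variables (p n : nat).
Variables (rP : mx_representation k G p) (rM : mx_representation k G n).
Variable pi : 'M[k]_(p, n).
Hypotheses (irrM : mx_irreducible rM) (coverP : projective_cover rP rM pi).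

(** Lift M to P by a linear section of pi and apply th: this endomorphism of the
    vector space M has an eigenvalue c. The lift of an eigenvector lies in the
    kernel of th - c pi but not in that of pi, so that kernel maps onto M and is
    all of P. *)
Lemma cover_hom_scalar (th : 'M[k]_(p, n)) :
  mx_hom rP rM th -> exists c, th = c *: pi.
Proof.
move=> homth; have [_ hompi fullpi esspi] := coverP.
have n0 : (0 < n)%N by case/mx_irrP: irrM.
have [c [w wE w0]] := closedField_eigenvalue (pinvmx pi *m th) n0.
have wpi : w *m pinvmx pi *m pi = w by rewrite mulmxKpV // submx_full.
exists c; apply/eqP; rewrite -subr_eq0; apply/eqP.
set d := th - c *: pi.
have homd : mx_hom rP rM d.
  move=> g Gg; rewrite mulmxBr mulmxBl homth //.
  by rewrite -scalemxAr -scalemxAl hompi.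
have modker : mxmodule rP (kermx d).
  apply/mxmoduleP=> g Gg; apply/sub_kermxP.
  by rewrite -mulmxA homd // mulmxA mulmx_ker mul0mx.
have wker : (w *m pinvmx pi <= kermx d)%MS.
  by apply/sub_kermxP; rewrite mulmxBr -mulmxA wE -scalemxAr wpi subrr.
suff /(esspi _ modker): row_full (kermx d *m pi).
  by rewrite -sub1mx => /sub_kermxP; rewrite mul1mx.
apply: (irr_image_full irrM hompi modker); apply: contraNneq w0 => kpi0.
by have [D DE] := submxP wker; rewrite -wpi DE -mulmxA kpi0 mulmx0.
Qed.

(** The idempotent e of the generator p0 maps M onto the line through p0 pi:
    v |-> sum_h eps(v h^-1) x h is a homomorphism P -> M taking p0 to xe. *)
Lemma idempotent_act_line (p0 : 'rV[k]_p) (eps : 'cV[k]_p) (x : 'rV[k]_n) :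
  exists c, galg_act rM (orbval rP eps p0) x = c *: (p0 *m pi).
Proof.
pose th := \sum_(h in G) rP h^-1%g *m eps *m (x *m rM h).
have thE v : v *m th = galg_act rM (orbval rP eps v) x.
  rewrite mulmx_sumr; apply: eq_bigr => h _.
  by rewrite !mulmxA -(mulmxA _ x) [v *m _ *m eps]mx11_scalar mul_scalar_mx.
have homth : mx_hom rP rM th.
  move=> g Gg; rewrite mulmx_sumr mulmx_suml -(sum_group_mulr _ Gg).
  apply: eq_bigr => h Gh; rewrite !mulmxA -repr_mxM ?groupV ?groupM //.
  by rewrite invMg mulKVg -!mulmxA -repr_mxM.
have [c thc] := cover_hom_scalar homth.
by exists c; rewrite -thE thc scalemxAr.
Qed.

Lemma symplectic_cover_involution (B : {biscalar 'rV[k]_n})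
    (b : {biscalar 'rV[k]_p}) :
  2%N \in [pchar k] -> symplectic_form rM B -> symplectic_form rP b ->
  exists2 t, (t \in G) && (#[t]%g == 2%N) & exists m, B (m *m rM t) m != 0.
Proof.
move=> k2 sympB sympb.
have [[Bnd _ _] [bnd _ balt] [_ hompi _ _]] := And3 sympB sympb coverP.
have BG := symplectic_invariantr sympB; have bG := symplectic_invariantr sympb.
have Bsym := symplectic_sym k2 sympB; have bsym := symplectic_sym k2 sympb.
have [m m0] : exists m : 'rV[k]_n, m != 0.
  have [n0 _] := (mx_irrP rM).1 irrM.
  exists (delta_mx 0 (Ordinal n0)); apply/eqP=> /matrixP/(_ 0 (Ordinal n0))/eqP.
  by rewrite !mxE !eqxx oner_eq0.
have [p0 [eps [p0pi epsP]]] := cover_dual_basis irrM coverP m0.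
pose e := orbval rP eps p0; pose e' h := e h^-1%g.
have actm : galg_act rM e m = m.
  by rewrite -{1}p0pi -(hom_galg_act _ _ hompi) /galg_act -epsP.
have [y Bmy] := nondegenerate_neq0 Bnd m0.
pose u := galg_act rM e' y.
have Bmu : B m u != 0 by rewrite -(galg_act_adjoint _ _ _ BG) actm.
(* The adjoint of an operator of rank one has rank one. *)
have act'u v : exists a, galg_act rM e' v = a *: u.
  exists (B m v / B m y); apply/eqP; rewrite -subr_eq0; apply/eqP/Bnd => x.
  have [c xE] := idempotent_act_line p0 eps x.
  rewrite Bsym linearBr linearZr_LR /= -!(galg_act_adjoint _ _ _ BG).
  by rewrite -/e in xE; rewrite xE p0pi !linearZl_LR /= mulrCA divfK // subrr.
pose s := \sum_(h in G) B (u *m rM h) m *: (p0 *m rP h).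
have s0 : s != 0.
  apply: contraNneq Bmu => s0; rewrite -actm (galg_act_adjoint _ _ _ BG).
  apply/eqP; transitivity ((s *m eps) 0 0); last by rewrite s0 mul0mx mxE.
  rewrite mulmx_suml summxE linear_sumr; apply: eq_bigr => h Gh.
  rewrite linearZr_LR /= Bsym -scalemxAl [RHS]mxE mulrC.
  by rewrite /e /orbval invgK.
have [w bsw] := nondegenerate_neq0 bnd s0.
pose F z := b p0 (p0 *m rP z).
pose S := \sum_(z in G) F z * B u (u *m rM z).
have S0 : S != 0.
  apply: contraNneq bsw => S0; rewrite [w]epsP linear_sumr big1 // => g Gg.
  rewrite linearZr_LR /=; apply/eqP; rewrite mulf_eq0; apply/orP; right.
  apply/eqP; pose v := m *m rM g^-1%g; have [a act'v] := act'u v.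
  have Fe z : z \in G -> F z = \sum_(x in G) e x * F (x * z)%g.
    move=> Gz; rewrite {1}/F {2}(epsP p0) mulmx_suml linear_sumr.
    apply: eq_bigr => x Gx.
    by rewrite -scalemxAl linearZr_LR /F repr_mxM ?mulmxA.
  have -> : b s (p0 *m rP g) = \sum_(z in G) F z * B u (v *m rM z).
    (* The term of h in s gives the term of z = g h^-1. *)
    rewrite -(sum_group_mull _ Gg) -sum_group_inv linear_sumlz.
    apply: eq_bigr => h Gh; have GVh : h^-1%g \in G by rewrite groupV.
    rewrite linearZl_LR /= mulrC; congr (_ * _).
      by rewrite -[LHS](bG h^-1%g) // repr_mxK // /F repr_mxM // mulmxA.
    by rewrite -[LHS](BG h^-1%g) // repr_mxK // /v repr_mxM // mulmxA repr_mxKV.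
  (* By Fe the sum is unchanged when v is replaced by its image under the
     adjoint of e, which is a multiple of u. *)
  transitivity (\sum_(z in G) F z * B u (galg_act rM e' v *m rM z)); last first.
    transitivity (a * S); last by rewrite S0 mulr0.
    rewrite act'v mulr_sumr; apply: eq_bigr => z Gz.
    by rewrite -scalemxAl linearZr_LR mulrCA.
  transitivity
    (\sum_(x in G) \sum_(z in G) e x * F (x * z)%g * B u (v *m rM z)).
    rewrite exchange_big; apply: eq_bigr => z Gz.
    by rewrite (Fe z) // mulr_suml.
  rewrite /galg_act -(sum_group_inv (V := 'rV_n)).
  transitivity (\sum_(x in G) \sum_(z in G)
      e x * (F z * B u (v *m rM x^-1%g *m rM z))).
    apply: eq_bigr => x Gx; rewrite -[RHS](sum_group_mull _ Gx).
    by apply: eq_bigr => z Gz; rewrite repr_mxM // mulmxA repr_mxKV // mulrA.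
  rewrite exchange_big; apply: eq_bigr => z Gz.
  rewrite mulmx_suml linear_sumr mulr_sumr; apply: eq_bigr => x Gx.
  by rewrite /e' invgK -scalemxAl linearZr_LR /= mulrCA.
have [/existsP[z /and3P[Gz /eqP zz Fz0]] | /existsPn noz] := boolP
  [exists z, [&& z \in G, (z * z)%g == 1%g & F z * B u (u *m rM z) != 0]].
  move: Fz0; rewrite mulf_eq0 negb_or => /andP[Fz Bz].
  exists z; last by exists u; rewrite Bsym.
  rewrite Gz (@nt_prime_order _ 2 z) //; apply: contraNneq Fz => ->.
  by rewrite /F repr_mx1 mulmx1 balt.
case/eqP: S0; rewrite /S sum_inv_pairs => [|r|z Gz]; last 2 first.
- exact: addrr_pchar2.
- rewrite /F -(bG z) // repr_mxKV // bsym; congr (_ * _).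
  by rewrite -(BG z) // repr_mxKV // Bsym.
- apply: big1 => z /andP[Gz zz]; apply/eqP; have := noz z.
  by rewrite Gz zz negbK.
Qed.

End ClosedCover.

Theorem theorem1p6 (k : closedFieldType) (gT : finGroupType) (G : {group gT})
    (n : nat) (rM : mx_representation k G n) (B : {biscalar 'rV[k]_n})
    (p : nat) (rP : mx_representation k G p) (pi : 'M[k]_(p, n)) :
  2%N \in [pchar k] ->
  (2 %| #|G|)%N ->
  mx_irreducible rM ->
  ~ mx_rsim rM (triv_repr k G) ->
  self_dual rM ->
  symplectic_form rM B ->
  projective_cover rP rM pi ->
  quadratic_type rP <->
  (exists2 t, (t \in G) && (#[t]%g == 2%N) & exists m, B (lact rM t m) m != 0).
Proof.
move=> k2 _ irrM _ _ sympB coverP; split.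
  case=> b [_ [sympb _ _ _]].
  have [t tG [m Bm]] := symplectic_cover_involution irrM coverP k2 sympB sympb.
  exists t => //; exists m; case/andP: tG => _ /eqP ot.
  by rewrite /lact (invg2id ot).
case=> t /andP[Gt /eqP ot] [m]; rewrite /lact (invg2id ot).
exact: (involution_quadratic_type irrM coverP k2 sympB Gt ot).
Qed.
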